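(* Let $D,N$ be integers with $D\ge 1$ and $D+1<N$. Then the Tanner graph of the matrix $M(D,D+1,N)$ has girth $6$.
   Context: Write $[N]=\{1,\dots,N\}$. For integers $D<K<N$, $M(D,K,N)$ is the $\binom{N}{D}\times\binom{N}{K}$ binary matrix whose rows are indexed by the $D$-element subsets of $[N]$ and whose columns are indexed by the $K$-element subsets of $[N]$, with a $1$ in position $(S,U)$ if and only if $S\subseteq U$. The Tanner graph of a binary matrix $H$ is the bipartite graph with one vertex (variable node) for each column and one vertex (check node) for each row, where a column vertex and a row vertex are adjacent if and only if the corresponding entry of $H$ is nonzero. The girth of a graph is the length of a shortest cycle. *)

(* Defs.v *)
From mathcomp Require Import all_boot all_order all_algebra.

Set Implicit Arguments.
Unset Strict Implicit.
Unset Printing Implicit Defensive.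

Definition ksubsets (N k : nat) : {set {set 'I_N}} :=
  [set S : {set 'I_N} | #|S| == k].

Lemma card_ksubsets (N k : nat) : #|ksubsets N k| = 'C(N, k).
Proof. by rewrite card_draws card_ord. Qed.

(* This is a bijection from 'I_'C(N, k) onto ksubsets N k: it fixes the order
   in which the rows and the columns of M D K N are listed. *)
Definition ksubset (N k : nat) (i : 'I_'C(N, k)) : {set 'I_N} :=
  enum_val (cast_ord (esym (card_ksubsets N k)) i).

(* The ground set {1, ..., N} is represented by 'I_N = {0, ..., N - 1}. *)
Definition M (D K N : nat) : 'M['F_2]_('C(N, D), 'C(N, K)) :=
  (\matrix_(i, j) (ksubset i \subset ksubset j)%:R)%R.

Definition tanner (m n : nat) (H : 'M['F_2]_(m, n)) : rel ('I_n + 'I_m) :=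
  fun x y =>
    match x, y with
    | inl j, inr i | inr i, inl j => (H i j != 0)%R
    | _, _ => false
    end.

Lemma tanner_sym (m n : nat) (H : 'M['F_2]_(m, n)) : symmetric (tanner H).
Proof. by case=> [j|i] [j'|i']. Qed.

Lemma tanner_irr (m n : nat) (H : 'M['F_2]_(m, n)) : irreflexive (tanner H).
Proof. by case. Qed.

(* A cycle of a simple graph is listed by its distinct vertices, without
   repeating the first one at the end, so its length is the size of the list.
   The bound on the size excludes the empty list and the lists [:: x; y] with
   x and y adjacent, which ucycleb accepts. *)
Definition graph_cycle (T : eqType) (e : rel T) (c : seq T) : bool :=
  (2 < size c) && ucycleb e c.

Definition has_girth (T : eqType) (e : rel T) (g : nat) : Prop :=
  (exists2 c : seq T, graph_cycle e c & size c = g) /\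
  (forall c : seq T, graph_cycle e c -> g <= size c).

(* Main.v *)
Require Import Defs.
From mathcomp Require Import all_boot all_order all_algebra.

Set Implicit Arguments.
Unset Strict Implicit.
Unset Printing Implicit Defensive.

(** Rows [S != T] and columns [U != V] cannot span a 4-cycle: [S :|: T] is
    contained in [U :&: V], but the former has at least [D + 1] elements and the
    latter at most [D]. As the graph is bipartite, its cycles have length at
    least 6. Conversely, let [Z] have [D + 2] elements, three of them [a], [b]
    and [c]: the columns [Z :\ a], [Z :\ b], [Z :\ c] and the rows obtained by
    removing two of the three elements form a 6-cycle. *)

Lemma card_ksubset (N k : nat) (i : 'I_('C(N, k))) : #|ksubset i| = k.
Proof.
by have := enum_valP (cast_ord (esym (card_ksubsets N k)) i); rewrite inE => /eqP.
Qed.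

Lemma ksubset_inj (N k : nat) : injective (@ksubset N k).
Proof. by move=> i j /enum_val_inj /cast_ord_inj. Qed.

Lemma ksubset_surj (N k : nat) (S : {set 'I_N}) :
  #|S| = k -> exists i : 'I_('C(N, k)), ksubset i = S.
Proof.
move=> cardS; have Sin : S \in ksubsets N k by rewrite inE cardS.
exists (cast_ord (card_ksubsets N k) (enum_rank_in Sin S)).
by rewrite /ksubset cast_ordK enum_rankK_in.
Qed.

Lemma M_neq0 (D K N : nat) (i : 'I_('C(N, D))) (j : 'I_('C(N, K))) :
  (M D K N i j != 0)%R = (ksubset i \subset ksubset j).
Proof. by rewrite mxE; case: (_ \subset _). Qed.

(** If the union were no larger than [A], then [B] would lie in [A], and equal cardinalities would
    force [A = B]. *)
Lemma cardsU_gt (T : finType) (A B : {set T}) :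
  #|A| = #|B| -> A != B -> #|A| < #|A :|: B|.
Proof.
move=> eqAB neAB; rewrite proper_card // properE subsetUl subUset subxx /=.
by apply: contra neAB => sBA; rewrite eq_sym eqEcard sBA eqAB leqnn.
Qed.

Lemma cardsI_lt (T : finType) (A B : {set T}) :
  #|A| = #|B| -> A != B -> #|A :&: B| < #|A|.
Proof.
move=> eqAB neAB; rewrite proper_card // properE subsetIl subsetI subxx /=.
by apply: contra neAB => sAB; rewrite eqEcard sAB eqAB leqnn.
Qed.

Lemma M_no_square (D N : nat) (i i' : 'I_('C(N, D))) (j j' : 'I_('C(N, D + 1))) :
  (M D (D + 1) N i j != 0)%R -> (M D (D + 1) N i j' != 0)%R ->
  (M D (D + 1) N i' j != 0)%R -> (M D (D + 1) N i' j' != 0)%R ->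
  i != i' -> j != j' -> False.
Proof.
rewrite !M_neq0 => ij ij' i'j i'j' neqi neqj.
have sub : ksubset i :|: ksubset i' \subset ksubset j :&: ksubset j'.
  by rewrite subUset !subsetI ij ij' i'j i'j'.
have ltU : D < #|ksubset i :|: ksubset i'|.
  rewrite -[X in X < _](card_ksubset i) cardsU_gt ?card_ksubset //.
  by rewrite (inj_eq (@ksubset_inj _ _)).
have ltI : #|ksubset j :&: ksubset j'| < D + 1.
  rewrite -[X in _ < X](card_ksubset j) cardsI_lt ?card_ksubset //.
  by rewrite (inj_eq (@ksubset_inj _ _)).
rewrite [X in _ < X]addn1 ltnS in ltI.
by have := leq_trans ltU (leq_trans (subset_leq_card sub) ltI); rewrite ltnn.
Qed.

(** Edges alternate between columns and rows, which rules out lengths 3 and 5; at length 4 the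
    vertices are two columns and two rows, the configuration that the hypothesis forbids. *)
Lemma tanner_cycle_ge6 (m n : nat) (H : 'M['F_2]_(m, n)) :
  (forall i i' j j', (H i j != 0)%R -> (H i j' != 0)%R ->
     (H i' j != 0)%R -> (H i' j' != 0)%R -> i != i' -> j != j' -> False) ->
  forall c, graph_cycle (tanner H) c -> 6 <= size c.
Proof.
move=> noC4 [|x1 [|x2 [|x3 [|x4 [|x5 [|x6 c]]]]]] //;
  case/and3P=> // _; rewrite /= ?inE ?andbT ?negb_or.
- by case: x1 x2 x3 => ? [] ? [] ? //=; rewrite ?andbF.
- case: x1 x2 x3 x4 => x1 [] x2 [] x3 [] x4 //=; rewrite ?andbF //.
  (* Only the two alternating patterns survive: here the cycle starts at a column, in the next case
     at a row. *)
  + by rewrite !andbT => /and4P[h1 h2 h3 h4] /andP[n1 n2];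
       case: (noC4 x2 x4 x1 x3).
  + by rewrite !andbT => /and4P[h1 h2 h3 h4] /andP[n1 n2];
       case: (noC4 x1 x3 x2 x4).
- by case: x1 x2 x3 x4 x5 => ? [] ? [] ? [] ? [] ? //=; rewrite ?andbF.
Qed.

Lemma M_hexagon (D N : nat) : 1 <= D -> D + 1 < N ->
  exists2 c, graph_cycle (tanner (M D (D + 1) N)) c & size c = 6.
Proof.
move=> D_gt0 ltDN.
have Cgt0 : 0 < 'C(N, D.+2) by rewrite bin_gt0; rewrite addn1 in ltDN.
have cardZ := card_ksubset (Ordinal Cgt0); set Z := ksubset _ in cardZ.
(* This is where [1 <= D] enters: [D + 2] must be at least 3. *)
have /card_gt2P[a [b [c [[aZ bZ cZ] [ab bc ca]]]]] : 2 < #|Z| by rewrite cardZ.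
have cardZ1 x : x \in Z -> #|Z :\ x| = D + 1.
  by move=> xZ; have := cardsD1 x Z; rewrite xZ cardZ add1n addn1 => -[<-].
have cardZ2 x y : x \in Z -> y \in Z -> x != y -> #|Z :\ x :\ y| = D.
  move=> xZ yZ xy; have := cardsD1 y (Z :\ x).
  by rewrite !inE yZ eq_sym xy cardZ1 // add1n addn1 => -[<-].
have [ja Ea] := ksubset_surj (cardZ1 a aZ).
have [jb Eb] := ksubset_surj (cardZ1 b bZ).
have [jc Ec] := ksubset_surj (cardZ1 c cZ).
have [iab Eab] := ksubset_surj (cardZ2 a b aZ bZ ab).
have [ibc Ebc] := ksubset_surj (cardZ2 b c bZ cZ bc).
have [ica Eca] := ksubset_surj (cardZ2 c a cZ aZ ca).
have neq k (i i' : 'I_('C(N, k))) x :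
    x \in ksubset i -> x \notin ksubset i' -> i != i'.
  by move=> xi; apply: contra => /eqP <-.
have ba : b != a by rewrite eq_sym.
have cb : c != b by rewrite eq_sym.
have ac : a != c by rewrite eq_sym.
exists [:: inl ja; inr iab; inl jb; inr ibc; inl jc; inr ica] => //.
(* A row [Z :\ x :\ y] lies in the column [Z :\ x] by construction; its other neighbour requires
   exchanging the two removals. *)
have sub_swap x y : Z :\ x :\ y \subset Z :\ y.
  by rewrite setDDl setUC -setDDl subsetDl.
rewrite /graph_cycle /ucycleb /= !M_neq0 Ea Eb Ec Eab Ebc Eca.
rewrite !subsetDl !sub_swap /= !inE /= /eq_op /= !orbF !andbT !negb_or.
(* Distinctness remains only between two columns or two rows. The last argument of [neq] is an
   element of the first set missing from the second. *)
rewrite (neq _ ja jb b) ?(neq _ ja jc c) ?(neq _ jb jc c) //;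
  rewrite ?(neq _ iab ibc c) ?(neq _ iab ica c) ?(neq _ ibc ica a) //;
  by rewrite ?(Ea, Eb, Ec, Eab, Ebc, Eca) !inE
             ?(eqxx, aZ, bZ, cZ, ab, ba, cb, ca, ac).
Qed.

Theorem corollary3p4 (D N : nat) (hD : 1 <= D) (hN : D + 1 < N) :
  has_girth (tanner (M D (D + 1) N)) 6.
Proof.
split; first exact: M_hexagon.
exact: tanner_cycle_ge6 (@M_no_square D N).
Qed.
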